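(* Each plain dependent type theory $(\mathbf{ctx},u,\dot u,\Sigma\dashv\Delta)$ produces a comprehension category: the natural transformation $\delta:=u\ast\epsilon:\dot u\Delta=u\Sigma\Delta\Rightarrow u$ (where $\epsilon:\Sigma\Delta\Rightarrow\mathrm{id}$ is the counit) corresponds to a functor $\mathrm{disp}:\mathcal U\to\mathbf{ctx}^{\mathsf 2}$, $A\mapsto(\delta_A:\dot u\Delta A\to uA)$, which satisfies $\mathrm{cod}\circ\mathrm{disp}=u$ and is a comprehension category over the fibration $u$.
   Context: Plain dependent type theory (pDTT): a category $\mathbf{ctx}$ (with terminal object), fibrations $u:\mathcal U\to\mathbf{ctx}$ and $\dot u:\dot{\mathcal U}\to\mathbf{ctx}$, a functor $\Sigma:\dot{\mathcal U}\to\mathcal U$ with $u\Sigma=\dot u$, and a right adjoint $\Delta:\mathcal U\to\dot{\mathcal U}$ of $\Sigma$ (not required to commute with the projections to $\mathbf{ctx}$), with unit $\eta$ and counit $\epsilon$, such that $\Sigma$ and $\Delta$ preserve cartesian morphisms and the components of $\eta$ and $\epsilon$ are cartesian (for $\dot u$ and $u$ respectively). $\mathbf{ctx}^{\mathsf 2}$ is the arrow category. Comprehension category (Jacobs): a fibration $u:\mathcal U\to\mathbf{ctx}$ with a functor $\mathrm{disp}:\mathcal U\to\mathbf{ctx}^{\mathsf 2}$ such that $\mathrm{cod}\circ\mathrm{disp}=u$ and $\mathrm{disp}$ sends $u$-cartesian morphisms to pullback squares in $\mathbf{ctx}$. *)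

(* Defs.v *)
From Stdlib Require Import ProofIrrelevance.

Set Implicit Arguments.
Unset Strict Implicit.
Unset Printing Implicit Defensive.

Record category := Category {
  ob :> Type;
  hom : ob -> ob -> Type;
  idc : forall a, hom a a;
  comp : forall a b c, hom b c -> hom a b -> hom a c;
  comp_id_l : forall a b (f : hom a b), comp (idc b) f = f;
  comp_id_r : forall a b (f : hom a b), comp f (idc a) = f;
  comp_assoc : forall a b c d (h : hom c d) (g : hom b c) (f : hom a b),
    comp h (comp g f) = comp (comp h g) f
}.
Arguments hom {_} _ _.
Arguments idc {_} a.
Arguments comp {_ a b c} _ _.

Notation "g \oc f" := (comp g f) (at level 40, left associativity).

Record functor (C D : category) := Functor {
  fobj :> C -> D;
  fmap : forall a b, hom a b -> hom (fobj a) (fobj b);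
  fmap_id : forall a, fmap (idc a) = idc (fobj a);
  fmap_comp : forall a b c (g : hom b c) (f : hom a b),
    fmap (g \oc f) = fmap g \oc fmap f
}.
Arguments fmap {C D} _ {a b} _.

Definition functor_id (C : category) : functor C C :=
  {| fobj := fun a => a; fmap := fun a b f => f;
     fmap_id := fun a => eq_refl; fmap_comp := fun a b c g f => eq_refl |}.

Program Definition functor_comp (C D E : category)
    (G : functor D E) (F : functor C D) : functor C E :=
  {| fobj := fun a => G (F a); fmap := fun a b f => fmap G (fmap F f) |}.
Next Obligation. intros; simpl; now rewrite !fmap_id. Qed.
Next Obligation. intros; simpl; now rewrite !fmap_comp. Qed.

Notation "G \oF F" := (functor_comp G F) (at level 40, left associativity).

Record nat_trans (C D : category) (F G : functor C D) := NatTrans {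
  component :> forall a, hom (F a) (G a);
  naturality : forall a b (f : hom a b),
    component b \oc fmap F f = fmap G f \oc component a
}.

Program Definition whisker (C D E : category) (H : functor D E)
    (F G : functor C D) (t : nat_trans F G) : nat_trans (H \oF F) (H \oF G) :=
  {| component := fun a => fmap H (t a) |}.
Next Obligation. intros; simpl; now rewrite <- !fmap_comp, naturality. Qed.

Record adjunction (C D : category) (L : functor C D) (R : functor D C) :=
  Adjunction {
  unit_of : nat_trans (functor_id C) (R \oF L);
  counit_of : nat_trans (L \oF R) (functor_id D);
  triangle_l : forall a, counit_of (L a) \oc fmap L (unit_of a) = idc (L a);
  triangle_r : forall b, fmap R (counit_of b) \oc unit_of (R b) = idc (R b)
}.

Definition is_terminal (C : category) (t : C) : Prop :=
  forall a : C, exists! f : hom a t, True.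

Section Fibration.
Variables (E B : category) (p : functor E B).

Definition cartesian (a b : E) (f : hom a b) : Prop :=
  forall (c : E) (g : hom c b) (w : hom (p c) (p a)),
    fmap p f \oc w = fmap p g ->
    exists! h : hom c a, fmap p h = w /\ f \oc h = g.

(* Grothendieck fibrations: the domain of a lift of [s] lies over the domain
   of [s] on the nose, and [fmap p f] equals [s] after transport along that
   equality.  No cleavage is chosen. *)
Definition is_fibration : Prop :=
  forall (b : E) (x : B) (s : hom x (p b)),
    exists (a : E) (e : p a = x) (f : hom a b),
      cartesian f /\
      eq_rect (p a) (fun y => hom y (p b)) (fmap p f) x e = s.
End Fibration.

Section Arrow.
Variable C : category.

Record arrow := Arrow { src : C; tgt : C; mor : hom src tgt }.

Record square (f g : arrow) := Square {
  top : hom (src f) (src g);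
  bot : hom (tgt f) (tgt g);
  square_comm : mor g \oc top = bot \oc mor f
}.

Lemma square_eq (f g : arrow) (s t : square f g) :
  top s = top t -> bot s = bot t -> s = t.
Proof.
destruct s as [s1 s2 s3], t as [t1 t2 t3]; simpl; intros -> ->.
f_equal; apply proof_irrelevance.
Qed.

Program Definition square_id (f : arrow) : square f f :=
  {| top := idc (src f); bot := idc (tgt f) |}.
Next Obligation. intros; simpl; now rewrite comp_id_l, comp_id_r. Qed.

Program Definition square_comp (f g h : arrow)
    (t : square g h) (s : square f g) : square f h :=
  {| top := top t \oc top s; bot := bot t \oc bot s |}.
Next Obligation.
intros; simpl.
now rewrite comp_assoc, square_comm, <- comp_assoc, square_comm, comp_assoc.
Qed.

Program Definition arrow_cat : category :=
  {| ob := arrow; hom := square; idc := square_id; comp := square_comp |}.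
Next Obligation. intros; simpl; apply square_eq; apply comp_id_l. Qed.
Next Obligation. intros; simpl; apply square_eq; apply comp_id_r. Qed.
Next Obligation. intros; simpl; apply square_eq; apply comp_assoc. Qed.

Definition cod : functor arrow_cat C :=
  {| fobj := tgt : arrow_cat -> C; fmap := bot;
     fmap_id := fun f => eq_refl; fmap_comp := fun f g h t s => eq_refl |}.

Definition is_pullback (f g : arrow) (s : square f g) : Prop :=
  forall (x : C) (h : hom x (src g)) (k : hom x (tgt f)),
    mor g \oc h = bot s \oc k ->
    exists! w : hom x (src f), top s \oc w = h /\ mor f \oc w = k.
End Arrow.

(* The functor to the arrow category that corresponds to [t]: it sends [a] to
   [t a] and [f] to the naturality square of [t] at [f]. *)
Program Definition arrow_functor (C D : category) (F G : functor C D)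
    (t : nat_trans F G) : functor C (arrow_cat D) :=
  {| fobj := (fun a => Arrow (t a)) : C -> arrow_cat D;
     fmap := fun a b f =>
       {| top := fmap F f; bot := fmap G f; square_comm := naturality t f |} |}.
Next Obligation. intros; simpl; apply square_eq; apply fmap_id. Qed.
Next Obligation. intros; simpl; apply square_eq; apply fmap_comp. Qed.

Record is_comprehension_category (B E : category)
    (u : functor E B) (disp : functor E (arrow_cat B)) : Prop := {
  compr_fibration : is_fibration u;
  compr_cod : cod B \oF disp = u;
  compr_pullback : forall (a b : E) (f : hom a b),
    cartesian u f -> is_pullback (fmap disp f)
}.

Record pdtt := PDTT {
  ctx : category;
  ctx_terminal : exists t : ctx, is_terminal t;
  U : category;
  Udot : category;
  u : functor U ctx;
  udot : functor Udot ctx;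
  u_fibration : is_fibration u;
  udot_fibration : is_fibration udot;
  Sigma : functor Udot U;
  u_Sigma : u \oF Sigma = udot;
  Delta : functor U Udot;
  adj : adjunction Sigma Delta;
  Sigma_cartesian : forall (a b : Udot) (f : hom a b),
    cartesian udot f -> cartesian u (fmap Sigma f);
  Delta_cartesian : forall (a b : U) (f : hom a b),
    cartesian u f -> cartesian udot (fmap Delta f);
  unit_cartesian : forall a : Udot, cartesian udot (unit_of adj a);
  counit_cartesian : forall a : U, cartesian u (counit_of adj a)
}.

Section Disp.
Variable T : pdtt.

(* [whisker] has type [u (Sigma Delta) => u id]; reassociating and dropping the
   identity functor leaves the components unchanged. *)
Definition whiskered_counit :
    nat_trans ((u T \oF Sigma T) \oF Delta T) (u T) :=
  let t := whisker (u T) (counit_of (adj T)) in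
  @NatTrans _ _ ((u T \oF Sigma T) \oF Delta T) (u T)
    (fun a => t a) (fun a b f => naturality t f).

(* The source is rewritten along the strict equality [u Sigma = udot]. *)
Definition delta : nat_trans (udot T \oF Delta T) (u T) :=
  eq_rect (u T \oF Sigma T) (fun F => nat_trans (F \oF Delta T) (u T))
    whiskered_counit (udot T) (u_Sigma T).

Definition disp : functor (U T) (arrow_cat (ctx T)) := arrow_functor delta.
End Disp.

(* Main.v *)
(** Let [f : A -> B] be cartesian, and let [h : x -> udot (Delta B)] and
    [k : x -> u A] satisfy [delta_B h = (u f) k]. Lift [h] to
    [h' : X -> Delta B]. Maps [w : x -> udot (Delta A)] over [h] correspond to
    factorizations of [h'] through the cartesian map [Delta f]; by transposition
    these are the factorizations of [eps_B (Sigma h')] through [f], and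
    [delta_A w = k] says that the transpose lies over [k]. As [f] is cartesian,
    there is exactly one such factorization. *)

From Stdlib Require Import ProofIrrelevance.
Require Import Defs.

Lemma functor_eq_fmap (C D : category) (o : C -> D)
    (m : forall a b, hom a b -> hom (o a) (o b))
    (i i' : forall a, m a a (idc a) = idc (o a))
    (c c' : forall a b d (g : hom b d) (f : hom a b),
      m a d (g \oc f) = m b d g \oc m a b f) :
  @Functor C D o m i c = @Functor C D o m i' c'.
Proof. f_equal; apply proof_irrelevance. Qed.

(** Both sides act identically by computation once [G] is a constructor; only the proofs of the
    functor laws differ. *)
Lemma cod_arrow_functor (C D : category) (F G : functor C D)
    (t : nat_trans F G) :
  cod D \oF arrow_functor t = G.
Proof. destruct G; apply functor_eq_fmap. Qed.

Section Transpose.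
Variables (C D : category) (L : functor C D) (R : functor D C).
Variable a : adjunction L R.

(* Retyped with plain objects in place of composite functors, so that rewriting
   matches syntactically. *)
Definition counit_at (y : D) : hom (L (R y)) y := counit_of a y.
Definition unit_at (x : C) : hom x (R (L x)) := unit_of a x.

Lemma counit_natural (x y : D) (f : hom x y) :
  counit_at y \oc fmap L (fmap R f) = f \oc counit_at x.
Proof. exact (naturality (counit_of a) f). Qed.

Lemma unit_natural (x y : C) (f : hom x y) :
  fmap R (fmap L f) \oc unit_at x = unit_at y \oc f.
Proof. symmetry; exact (naturality (unit_of a) f). Qed.

Lemma counit_unit (x : C) : counit_at (L x) \oc fmap L (unit_at x) = idc (L x).
Proof. exact (triangle_l a x). Qed.

Lemma unit_counit (y : D) : fmap R (counit_at y) \oc unit_at (R y) = idc (R y).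
Proof. exact (triangle_r a y). Qed.

Definition transpose (x : C) (y : D) (g : hom (L x) y) : hom x (R y) :=
  fmap R g \oc unit_at x.

Lemma counit_transpose (x : C) (y : D) (g : hom (L x) y) :
  counit_at y \oc fmap L (transpose x y g) = g.
Proof.
unfold transpose; rewrite fmap_comp, comp_assoc, counit_natural, <- comp_assoc.
now rewrite counit_unit, comp_id_r.
Qed.

Lemma transpose_counit (x : C) (y : D) (k : hom x (R y)) :
  transpose x y (counit_at y \oc fmap L k) = k.
Proof.
unfold transpose; rewrite fmap_comp, <- comp_assoc, unit_natural, comp_assoc.
now rewrite unit_counit, comp_id_l.
Qed.

Lemma transpose_comp (x : C) (y z : D) (f : hom y z) (g : hom (L x) y) :
  transpose x z (f \oc g) = fmap R f \oc transpose x y g.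
Proof. unfold transpose; now rewrite fmap_comp, comp_assoc. Qed.
End Transpose.

(** With [p \oF L] in the role of [udot], no transport along [u_Sigma] occurs. *)
Lemma whiskered_counit_pullback (B E F : category) (p : functor E B)
    (L : functor F E) (R : functor E F) (a : adjunction L R)
    (fib : is_fibration (p \oF L))
    (Rcart : forall (x y : E) (f : hom x y),
      cartesian p f -> cartesian (p \oF L) (fmap R f))
    (x y : E) (f : hom x y) (fcart : cartesian p f) :
  is_pullback (fmap (arrow_functor (whisker p (counit_of a))) f).
Proof.
intros z h k; simpl in *.
change (counit_of a x) with (counit_at _ _ _ _ a x).
change (counit_of a y) with (counit_at _ _ _ _ a y).
intros comm.
destruct (fib (R y) z h) as (X & e & h' & _ & over_h).
(* As [z] is a variable, it can be replaced by [p (L X)], and [h] by the image of [h']. *)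
destruct e; simpl in over_h; subst h.
assert (factor : exists! g : hom (L X) x, fmap p g = k /\
  f \oc g = counit_at _ _ _ _ a y \oc fmap L h').
{ apply fcart; rewrite fmap_comp; symmetry; exact comm. }
destruct factor as (g & [over_k fg] & g_unique).
exists (fmap (p \oF L) (transpose _ _ _ _ a _ _ g)).
split; [split|].
- simpl; rewrite <- !fmap_comp, <- transpose_comp, fg.
  now rewrite transpose_counit.
- simpl; now rewrite <- fmap_comp, counit_transpose.
- intros w [top_w bot_w].
  (* Any competitor [w] is the image of some [g'], and the transpose of [g'] must be [g]. *)
  destruct (Rcart _ _ _ fcart X h' w top_w) as (g' & [over_w fg'] & _).
  rewrite <- over_w; f_equal.
  rewrite <- (transpose_counit _ _ _ _ a _ _ g'); f_equal.
  apply g_unique; split.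
  + rewrite fmap_comp, <- bot_w; f_equal; exact over_w.
  + now rewrite comp_assoc, <- counit_natural, <- comp_assoc, <- fmap_comp, fg'.
Qed.

Theorem mainTheorem6 (T : pdtt) :
  (forall A : U T,
     disp T A = @Arrow (ctx T) (udot T (Delta T A)) (u T A) (delta T A)) /\
  is_comprehension_category (u T) (disp T).
Proof.
split; [reflexivity | split].
- apply u_fibration.
- apply cod_arrow_functor.
- destruct T as [ctx tm U Ud u ud ufib udfib S uS D adj Sc Dc uc cc].
  unfold disp, delta; simpl.
  (* Now [ud] is a variable, so eliminating [uS] makes the transport in [delta] compute away. *)
  destruct uS; simpl.
  exact (whiskered_counit_pullback _ _ _ u S D adj udfib Dc).
Qed.
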